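(* Let $D$ be a strong digraph of order $n\ge 3$. Suppose that every vertex $u$ of $D$ which belongs to a nonadjacent dominating pair or a nonadjacent dominated pair satisfies $d(u)\ge n$. Then $D$ contains a (directed) $3$-cycle, unless $n$ is even and $D\in\mathcal{D}_B$, or $D\in\mathcal{D}_L$ and every strong semicomplete digraph $S$ among $S_1,\dots,S_r$ in the round decomposition $D=R[S_1,\dots,S_r]$ of $D$ satisfies $|V(S)|\le 2$.
   Context: All digraphs are finite, without loops and without multiple (parallel) arcs; a pair of opposite arcs $uv$, $vu$ (a $2$-cycle) is allowed. Paths and cycles are directed. The order of $D$ is $|V(D)|$. $D$ is strong if for any two vertices $x,y$ there is a directed path from $x$ to $y$ (a single vertex is strong). $d^+(u),d^-(u)$ are the out- and in-degree, $N^+(u),N^-(u)$ the out- and in-neighborhoods, and $d(u)=d^+(u)+d^-(u)$ is the total number of arcs incident with $u$. Two distinct vertices are adjacent if there is at least one arc between them, and nonadjacent otherwise. A pair $\{x,y\}$ of distinct nonadjacent vertices is a nonadjacent dominated pair if $x,y$ have a common in-neighbor (some $z$ with arcs $zx$ and $zy$), and a nonadjacent dominating pair if they have a common out-neighbor (some $z$ with arcs $xz$ and $yz$). $\mathcal{D}_B$ is the class of balanced complete bipartite digraphs with at least $4$ vertices: the vertex set is partitioned into two independent sets of equal size, and for all $x,y$ in different parts both arcs $xy$ and $yx$ are present. A digraph is semicomplete if any two distinct vertices are adjacent. A locally semicomplete digraph (LSD) is a digraph in which the in-neighborhood of each vertex induces a semicomplete digraph and the out-neighborhood of each vertex induces a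 semicomplete digraph. A local tournament is an LSD without $2$-cycles. A digraph on $m$ vertices is round if its vertices can be labelled $v_0,\dots,v_{m-1}$ so that for each $i$, $N^+(v_i)=\{v_{i+1},\dots,v_{i+d^+(v_i)}\}$ and $N^-(v_i)=\{v_{i-d^-(v_i)},\dots,v_{i-1}\}$, subscripts modulo $m$. For a local tournament $R$ with vertices $v_1,\dots,v_r$ and strong semicomplete digraphs $S_1,\dots,S_r$, $R[S_1,\dots,S_r]$ denotes the digraph obtained from $R$ by replacing each vertex $v_i$ by $S_i$ and each arc $v_iv_j$ by all arcs from $V(S_i)$ to $V(S_j)$; an expression $D=R[S_1,\dots,S_r]$ is called the round decomposition of $D$. The girth $g(R)$ is the length of a shortest (directed) cycle in $R$. $\mathcal{D}_L$ is the class of strong LSDs $D$ of the form $D=R[S_1,\dots,S_r]$, where $R$ is a round local tournament, each $S_i$ is a strong semicomplete digraph, and $g(R)>\max\{2,|V(S_1)|,\dots,|V(S_r)|\}+1$. The round decomposition referred to in the claim for $D\in\mathcal{D}_L$ is this one. *)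

(* Defs.v *)
From mathcomp Require Import all_boot.

Set Implicit Arguments.
Unset Strict Implicit.
Unset Printing Implicit Defensive.

(* Loops are excluded by arc_irr, parallel arcs by arc being a relation;      *)
(* opposite arcs are allowed.  Vertex sets are nonempty, so that in           *)
(* particular the S i in a composition R[S_1, ..., S_r] are nonempty.         *)
Record digraph := Digraph {
  vertex :> finType;
  arc : rel vertex;
  arc_irr : irreflexive arc;
  vertex_gt0 : 0 < #|vertex|
}.

Section Digraphs.
Variable D : digraph.
Implicit Types (u x y z : D) (A : {set D}).

Definition outN x : {set D} := [set y | arc x y].
Definition inN x : {set D} := [set y | arc y x].
Definition outdeg x := #|outN x|.
Definition indeg x := #|inN x|.
Definition deg x := outdeg x + indeg x.

Definition strong : Prop := forall x y, connect (@arc D) x y.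

Definition adjacent x y := arc x y || arc y x.

Definition nonadjacent_dominated_pair x y : Prop :=
  [/\ x != y, ~~ adjacent x y & exists z, arc z x && arc z y].

Definition nonadjacent_dominating_pair x y : Prop :=
  [/\ x != y, ~~ adjacent x y & exists z, arc x z && arc y z].

(* A directed k-cycle; since there are no loops, k >= 2. *)
Definition has_dicycle k : Prop :=
  exists2 c : seq D, size c = k & (0 < k) && ucycleb (@arc D) c.

Definition is_girth g : Prop :=
  has_dicycle g /\ forall k, has_dicycle k -> g <= k.

Definition induces_semicomplete A : Prop :=
  forall x y, x \in A -> y \in A -> x != y -> adjacent x y.

Definition semicomplete : Prop := induces_semicomplete [set: D].

Definition locally_semicomplete : Prop :=
  forall x, induces_semicomplete (inN x) /\ induces_semicomplete (outN x).

Definition local_tournament : Prop :=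
  locally_semicomplete /\ ~ has_dicycle 2.

(* With m = #|D|, ordS and ord_pred are i |-> i + 1 and i |-> i - 1 mod m.    *)
Definition round : Prop :=
  exists2 v : 'I_#|D| -> D, bijective v &
    forall i : 'I_#|D|,
      outN (v i) = [set v (iter k.+1 (@ordS _) i) | k : 'I_(outdeg (v i))] /\
      inN (v i) = [set v (iter k.+1 (@ord_pred _) i) | k : 'I_(indeg (v i))].

Definition independent A : Prop :=
  forall x y, x \in A -> y \in A -> ~~ adjacent x y.

Definition class_DB : Prop :=
  4 <= #|D| /\
  exists A : {set D},
    [/\ #|A| = #|~: A|, independent A, independent (~: A) &
        forall x y, x \in A -> y \in ~: A -> arc x y /\ arc y x].

End Digraphs.

Section Composition.
Variables (R : digraph) (S : R -> digraph).

Definition comp_vertex : finType := {i : R & S i}.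

Definition comp_arc : rel comp_vertex := fun p q =>
  if tag p == tag q then arc (tagged p) (tagged_as p q)
  else arc (tag p) (tag q).

Lemma comp_arc_irr : irreflexive comp_arc.
Proof. by case=> i x; rewrite /comp_arc eqxx tagged_asE arc_irr. Qed.

Lemma comp_vertex_gt0 : 0 < #|comp_vertex|.
Proof.
have /card_gt0P[i _] := vertex_gt0 R.
have /card_gt0P[x _] := vertex_gt0 (S i).
by apply/card_gt0P; exists (Tagged (fun j : R => S j) x).
Qed.

(* R[S_1, ..., S_r], with the S_i indexed by the vertices of R. *)
Definition composition : digraph := Digraph comp_arc_irr comp_vertex_gt0.

End Composition.

Definition isomorphic (D E : digraph) : Prop :=
  exists2 f : D -> E, bijective f & forall x y, arc (f x) (f y) = arc x y.

(* D = R[S_1, ..., S_r] witnesses that D belongs to the class D_L. *)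
Definition DL_decomposition (D R : digraph) (S : R -> digraph) : Prop :=
  [/\ strong D /\ locally_semicomplete D,
      isomorphic D (composition S),
      round R /\ local_tournament R,
      forall i : R, strong (S i) /\ semicomplete (S i) &
      exists2 g, is_girth R g & (maxn 2 (\max_(i : R) #|S i|)).+1 < g].

(* Main.v *)
From mathcomp Require Import all_boot.
Require Import Defs.

(* Let D have no 3-cycle.  If u is a nonadjacent dominating or dominated      *)
(* vertex and b is joined to u in both directions, then every y satisfies     *)
(* c(u,y) + c(b,y) <= 2, where c counts arcs in both directions.  Summing,    *)
(* deg u + deg b <= 2n; as both degrees are at least n, all these             *)
(* inequalities are equalities, and then strong connectivity leaves no vertex *)
(* joined to u by exactly one arc: D is balanced complete bipartite.          *)
(*   If there is no such u, D is locally semicomplete.  Vertices on a common  *)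
(* 2-cycle are twins, the twin classes have at most two elements, and         *)
(* contracting them yields a local tournament R without 3-cycles.  In R every *)
(* N^+(x) is transitive; mapping x to the source of N^+(x) is a permutation   *)
(* of R with a single cycle, and this cyclic order is a round labelling.      *)

Set Implicit Arguments.
Unset Strict Implicit.
Unset Printing Implicit Defensive.

(** The counting rests on [arcs_between_digon], and [class_DB_of_nonadjacent_pair] reads the
    bipartition off as the neighbourhood of u and its complement. In the locally semicomplete case
    [twin_arc] justifies the contraction, and [arc_iter_succ] turns every arc of R into a run of
    [succ] steps, which gives both the single cycle and roundness. The girth exceeds 3 because R has
    neither 2-cycles nor 3-cycles. *)

Definition triangle_free (D : digraph) : Prop :=
  forall x y z : D, arc x y -> arc y z -> arc z x -> False.

Lemma has_dicycle3P (D : digraph) : has_dicycle D 3 \/ triangle_free D.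
Proof.
case: (boolP [exists x : D, exists y : D, exists z : D,
                [&& arc x y, arc y z & arc z x]]).
  case/existsP=> x /existsP[y /existsP[z /and3P[xy yz zx]]]; left.
  exists [:: x; y; z] => //=; rewrite /ucycleb /= xy yz zx /= !inE negb_or.
  have neq (a b : D) : arc a b -> a != b.
    by apply: contraTneq => ->; rewrite arc_irr.
  by rewrite (neq _ _ xy) (neq _ _ yz) andbT eq_sym (neq _ _ zx).
move=> no3; right=> x y z xy yz zx; case/negP: no3.
by apply/existsP; exists x; apply/existsP; exists y; apply/existsP; exists z;
  rewrite xy yz.
Qed.

Lemma triangle_freeN3 (D : digraph) : triangle_free D -> ~ has_dicycle D 3.
Proof.
move=> tf [[|x [|y [|z []]]] //= _ /andP[/and4P[xy yz zx _] _]].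
exact: (tf x y z).
Qed.

Lemma connect_closed_pred (T : finType) (e : rel T) (P : pred T) (x y : T) :
  (forall a b, P a -> e a b -> P b) -> connect e x y -> P x -> P y.
Proof.
move=> Pe /connectP[p ep ->]; elim: p x ep => //= a p IHp x /andP[xa /IHp] + Px.
by apply; apply: Pe xa.
Qed.

(** * Counting arcs around a 2-cycle *)

Section ArcCount.
Variable D : digraph.
Implicit Types (u b x y z : D).

Definition arcs_between x y : nat := arc x y + arc y x.

Lemma deg_sum x : deg x = \sum_y arcs_between x y.
Proof.
rewrite big_split /= /deg /outdeg /indeg -!sum1_card.
by congr (_ + _); rewrite big_mkcond; apply: eq_bigr => y _; rewrite inE;
  case: (arc _ _).
Qed.

Hypothesis tf : triangle_free D.

(** The four possible arcs form two pairs, b -> y with y -> u and u -> y with y -> b; a complete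
    pair closes a 3-cycle with the 2-cycle on u and b. *)
Lemma arcs_between_digon u b y : arc u b -> arc b u ->
  arcs_between u y + arcs_between b y <= 2.
Proof.
move=> ub bu; rewrite /arcs_between.
case uy: (arc u y); case yu: (arc y u); case b_y: (arc b y);
  case y_b: (arc y b) => //.
all: by case: (tf ub b_y yu) || case: (tf bu uy y_b).
Qed.

End ArcCount.

(** * The balanced complete bipartite case *)

Section Bipartite.
Variables (D : digraph) (u v : D).
Hypotheses (tf : triangle_free D) (strongD : strong D).
Hypothesis degree_cond : forall x : D,
  (exists y : D, nonadjacent_dominating_pair x y \/
                 nonadjacent_dominated_pair x y) -> #|D| <= deg x.
Hypothesis uv : nonadjacent_dominating_pair u v \/
                nonadjacent_dominated_pair u v.

Let B := outN u :&: inN u.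

Let deg_u : #|D| <= deg u.
Proof. by apply: degree_cond; exists v. Qed.

(** Each y is joined to u by at most one arc, or two if y is in B, and by none if y is u or v;
    summing gives deg u + 2 <= n + |B|. *)
Let card_B : 1 < #|B|.
Proof.
have [v_u Nuv] : v != u /\ ~~ adjacent u v.
  by rewrite eq_sym; case: uv => -[].
have: \sum_(y : D) (arcs_between u y + ((y == u) + (y == v)))
      <= \sum_(y : D) (1 + (y \in B)).
  apply: leq_sum => y _; rewrite !inE /arcs_between.
  case: (eqVneq y u) => [->|_]; first by rewrite arc_irr eq_sym (negPf v_u).
  case: eqVneq => [->|_]; last by case: (arc u y); case: (arc y u).
  by move: Nuv; rewrite /adjacent; case: (arc u v); case: (arc v u).
have sum_pred1 x : \sum_(y : D) (y == x : nat) = 1.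
  by rewrite (bigD1 x) //= eqxx big1 // => y /negPf->.
rewrite [X in X <= _]big_split -deg_sum /= !big_split /= !sum_pred1 sum1_card.
have -> : \sum_(y : D) (y \in B : nat) = #|B|.
  by rewrite -sum1_card [RHS]big_mkcond; apply: eq_bigr => y _; case: (y \in B).
by move=> /(leq_trans (leq_add deg_u (leqnn _))); rewrite leq_add2l.
Qed.

(** B has a second member c. An arc between b and c would close a 3-cycle with u, so b and c are
    nonadjacent with common out-neighbour u. *)
Let deg_B b : b \in B -> #|D| <= deg b.
Proof.
move=> Bb; have /[!inE] /andP[ub bu] := Bb.
have /card_gt0P[c] : 0 < #|B :\ b|.
  by move: card_B; rewrite (cardsD1 b) Bb.
rewrite !inE => /and3P[c_b uc cu]; apply: degree_cond; exists c; left.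
split; [by rewrite eq_sym | | by exists u; rewrite bu cu].
by apply/norP; split; apply/negP => bc;
  [apply: (tf ub bc cu) | apply: (tf uc bc bu)].
Qed.

(** Each term is at most 2, while the sum over y is deg u + deg b >= 2n. *)
Let arcs_B b y : b \in B -> arcs_between u y + arcs_between b y = 2.
Proof.
move=> Bb; have /[!inE] /andP[ub bu] := Bb.
have le2 z : arcs_between u z + arcs_between b z <= 2.
  exact: arcs_between_digon.
have: \sum_(z : D) 2 <= \sum_(z : D) (arcs_between u z + arcs_between b z).
  rewrite big_split /= -!deg_sum sum_nat_const muln2 -addnn.
  by apply: leq_add; last exact: deg_B.
rewrite (bigD1 y) // [X in _ <= X](bigD1 y) //= => ge2.
apply/eqP; rewrite eqn_leq le2 -(leq_add2r (\sum_(z | z != y) 2)).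
by apply: leq_trans ge2 _; rewrite leq_add2l; apply: leq_sum.
Qed.

(* The y with u -> y but not y -> u form a set closed under out-neighbours,   *)
(* which must be empty by strong connectivity; the other case is dual.        *)
Let arc_sym_u y : arc u y = arc y u.
Proof.
have /card_gt0P[b Bb] : 0 < #|B| by apply: ltnW.
have /[!inE] /andP[ub bu] := Bb.
have arc_b w : ~~ arc u w -> ~~ arc w u -> arc b w && arc w b.
  move=> /negPf uw /negPf wu; have := arcs_B w Bb.
  by rewrite /arcs_between uw wu; case: (arc b w); case: (arc w b).
apply/idP/idP => [uy|yu]; apply/negPn/negP => N.
  suff: arc u u && ~~ arc u u by rewrite arc_irr.
  apply: (connect_closed_pred (P := fun w => arc u w && ~~ arc w u)
    _ (strongD y u)); last by rewrite uy.
  move=> a w /andP[ua /negPf au] aw.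
  have wu : ~~ arc w u by apply/negP; apply: (tf ua aw).
  (* A w nonadjacent to u would lie on a 2-cycle with b; since [arcs_B] forces b -> a, the vertices
     b, a, w would form a 3-cycle. *)
  rewrite wu andbT; apply/negPn/negP => uw.
  have /andP[bw wb] := arc_b w uw wu.
  have ba : arc b a.
    have := arcs_B a Bb; rewrite /arcs_between ua au.
    by case: (arc b a) => //; case ab: (arc a b) => //; case: (tf ua ab bu).
  exact: (tf ba aw wb).
suff: ~~ (arc y u && ~~ arc u y) by rewrite yu N.
(* The dual set is closed under in-neighbours, so its complement is what propagates forwards, from u
   to y. *)
apply: (connect_closed_pred (P := fun w => ~~ (arc w u && ~~ arc u w))
  _ (strongD u y)); last by rewrite arc_irr.
move=> w a + wa; apply: contra => /andP[au /negPf ua].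
have uw : ~~ arc u w by apply/negP => uw; apply: (tf uw wa au).
rewrite uw andbT; apply/negPn/negP => wu.
have /andP[bw wb] := arc_b w uw wu.
have ab : arc a b.
  have := arcs_B a Bb; rewrite /arcs_between au ua.
  by case: (arc a b) => //; case ba: (arc b a) => //; case: (tf ub ba au).
exact: (tf ab bw wa).
Qed.

Lemma class_DB_of_nonadjacent_pair : class_DB D.
Proof.
have inB y : (y \in B) = arc u y by rewrite !inE -arc_sym_u andbb.
have arc_B b y : arc u b -> arc b y = ~~ arc u y /\ arc y b = ~~ arc u y.
  rewrite -inB => /(arcs_B y); rewrite /arcs_between -arc_sym_u.
  by case: (arc u y); case: (arc b y); case: (arc y b).
have [b ub] : exists b, arc u b.
  by have /card_gt0P[b] := ltnW card_B; exists b; rewrite -inB.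
(* Here deg u = 2|B| and deg b = 2|~: B| are both at least n = |B| + |~: B|. *)
have cardBC : #|B| = #|~: B|.
  have Eo : outN u = B by apply/setP=> y; rewrite inE inB.
  have Ei : inN u = B by apply/setP=> y; rewrite inE inB arc_sym_u.
  have Eob : outN b = ~: B.
    by apply/setP=> y; rewrite in_setC inB inE (arc_B b y ub).1.
  have Eib : inN b = ~: B.
    by apply/setP=> y; rewrite in_setC inB inE (arc_B b y ub).2.
  have := deg_u; have := deg_B (b := b); rewrite inB /deg /outdeg /indeg.
  rewrite Eo Ei Eob Eib -(cardsC B) leq_add2l leq_add2r => /(_ ub) le1 le2.
  by apply/eqP; rewrite eqn_leq le1.
split; first by rewrite -(cardsC B) -cardBC (leq_add card_B card_B).
exists B; split=> // x y; rewrite ?in_setC !inB /adjacent.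
- by move=> ux uy; have [-> ->] := arc_B x y ux; rewrite uy.
- move=> ux uy; have [bx xb] := arc_B b x ub; have [b_y yb] := arc_B b y ub.
  rewrite ux in bx xb; rewrite uy in b_y yb.
  by apply/norP; split; apply/negP => xy;
    [apply: (tf xy yb) | apply: (tf xy xb)].
- by move=> ux uy; have [-> ->] := arc_B x y ux.
Qed.

End Bipartite.

Lemma arc_neq (E : digraph) (x y : E) : arc x y -> x != y.
Proof. by apply: contraTneq => ->; rewrite arc_irr. Qed.

Lemma strong_out (E : digraph) (x : E) :
  strong E -> 1 < #|E| -> exists y, arc x y.
Proof.
move=> strongE /card_gt1P[a [b [_ _ ab]]].
have [y xy]: exists y, x != y.
  by case: (eqVneq x a) ab => [->|xa _]; [exists b | exists a].
have /connectP[[|z p] /=] := strongE x y.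
  by move=> _ E0; rewrite E0 eqxx in xy.
by case/andP=> xz _ _; exists z.
Qed.

(** * The successor permutation of a triangle-free local tournament *)

Section Round.
Variable D : digraph.
Hypotheses (tf : triangle_free D) (strongD : strong D).
Hypothesis LSD : locally_semicomplete D.
Hypothesis no_digon : forall x y : D, arc x y -> ~~ arc y x.
Hypothesis D_gt1 : 1 < #|D|.
Implicit Types x y z p w : D.

Lemma out_arc x y z : arc x y -> arc x z -> y != z -> arc y z || arc z y.
Proof. by move=> xy xz; apply: (proj2 (LSD x)); rewrite inE. Qed.

Lemma in_arc x y z : arc y x -> arc z x -> y != z -> arc y z || arc z y.
Proof. by move=> xy xz; apply: (proj1 (LSD x)); rewrite inE. Qed.

(* A vertex of N^+(x) with the most out-neighbours inside N^+(x) dominates   *)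
(* the rest of N^+(x).                                                        *)
Lemma succ_exists x :
  exists y, arc x y && [forall z, arc x z ==> ((z == y) || arc y z)].
Proof.
have [y0 xy0] := strong_out x strongD D_gt1.
pose y := [arg max_(y > y0 | arc x y) #|outN y :&: outN x|].
have [xy maxy] : arc x y /\
    forall z, arc x z -> #|outN z :&: outN x| <= #|outN y :&: outN x|.
  by rewrite /y; case: arg_maxnP.
exists y; rewrite xy; apply/forallP => z; apply/implyP => xz.
case: eqVneq => //= z_y; apply: contraT => yz.
have zy : arc z y by have := out_arc xz xy z_y; rewrite (negPf yz) orbF.
have: #|outN y :&: outN x| < #|outN z :&: outN x|.
  apply: proper_card; apply/properP; split; last first.
    by exists y; rewrite !inE ?zy ?xy ?arc_irr.
  apply/subsetP => w; rewrite !inE => /andP[yw xw]; rewrite xw andbT.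
  have zw : z != w by apply: contraNneq yz => ->.
  by case/orP: (out_arc xz xw zw) => // wz; case: (tf zy yw wz).
by rewrite ltnNge maxy.
Qed.

Definition succ x := xchoose (succ_exists x).

Lemma arc_succ x : arc x (succ x).
Proof. by case/andP: (xchooseP (succ_exists x)). Qed.

Lemma succ_source x z : arc x z -> z = succ x \/ arc (succ x) z.
Proof.
case/andP: (xchooseP (succ_exists x)) => _ /forallP/(_ z)/implyP H.
by case/H/orP => [/eqP|]; [left | right].
Qed.

(** Two in-neighbours of [succ x] are adjacent, and x -> z would by [succ_source] create a loop or a
    2-cycle at [succ x]. *)
Lemma succ_sink x z : arc z (succ x) -> z = x \/ arc z x.
Proof.
move=> zs; case: (eqVneq z x) => [|zx]; [by left | right].
case/orP: (in_arc zs (arc_succ x) zx) => // xz.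
case: (succ_source xz) => [E|]; first by rewrite -E arc_irr in zs.
by move=> sz; have := no_digon zs; rewrite sz.
Qed.

Lemma succ_inj : injective succ.
Proof.
move=> x y E; have := arc_succ x; rewrite E => /succ_sink[//|xy].
have := arc_succ y; rewrite -E => /succ_sink[//|yx].
by have := no_digon xy; rewrite yx.
Qed.

(* The number of steps is at most outdeg x and at most indeg y, so mere       *)
(* cardinality turns this inclusion into the equalities defining a round      *)
(* labelling.                                                                 *)
Lemma arc_iter_succ x y : arc x y -> y = iter #|outN x :&: inN y|.+1 succ x.
Proof.
move: {2}_.+1 (ltnSn #|outN x :&: inN y|) => n.
elim: n y => // n IHn y le_n xy.
case: (eqVneq y (succ x)) => [Ey|y_s].
  suff -> : outN x :&: inN y = set0 by rewrite cards0.
  apply/setP => w; rewrite !inE; apply/negP => /andP[xw].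
  rewrite Ey; case: (succ_source xw) => [->|/no_digon/negP//].
  by rewrite arc_irr.
(* Stepping back from y to its predecessor p removes exactly p from the vertices between x and y. *)
have [p Ep] : exists p, succ p = y.
  by exists (finv succ y); apply: f_finv succ_inj y.
have xp : arc x p.
  by have := xy; rewrite -Ep => /succ_sink[E|//]; rewrite -Ep E eqxx in y_s.
have py : arc p y by rewrite -Ep arc_succ.
have E : outN x :&: inN y = p |: (outN x :&: inN p).
  apply/setP => w; rewrite !inE; case: (eqVneq w p) => [->|w_p].
    by rewrite xp py.
  apply/andP/andP => -[xw wy]; split=> //.
    by move: wy; rewrite -Ep => /succ_sink[E|//]; rewrite E eqxx in w_p.
  have w_y : w != y by apply: contraTneq wy => ->; apply: no_digon.
  by case/orP: (out_arc xw xy w_y) => // yw; case: (tf yw wy py).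
have cardE : #|outN x :&: inN y| = #|outN x :&: inN p|.+1.
  by rewrite E cardsU1 !inE arc_irr andbF.
by rewrite cardE iterS -IHn // -ltnS -cardE.
Qed.

Lemma card_between_out x y : arc x y -> #|outN x :&: inN y| < outdeg x.
Proof.
move=> xy; apply: proper_card; apply/properP; split; first exact: subsetIl.
by exists y; rewrite !inE ?arc_irr ?andbF.
Qed.

Lemma card_between_in x y : arc x y -> #|outN x :&: inN y| < indeg y.
Proof.
move=> xy; apply: proper_card; apply/properP; split; first exact: subsetIr.
by exists x; rewrite !inE ?arc_irr.
Qed.

(** By [arc_iter_succ] a [succ]-orbit is closed under arcs, so strong connectivity makes it all of
    D. *)
Lemma fconnect_succ x y : fconnect succ x y.
Proof.
apply: (connect_closed_pred (P := fconnect succ x) _ (strongD x y)).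
  move=> a b xa /arc_iter_succ ->; apply: connect_trans xa _.
  exact: fconnect_iter.
exact: connect0.
Qed.

Lemma order_succ x : order succ x = #|D|.
Proof. by apply: eq_card => y; rewrite inE -topredE /= fconnect_succ. Qed.

Lemma outN_succ x : outN x = [set iter k.+1 succ x | k : 'I_(outdeg x)].
Proof.
apply/eqP; rewrite eqEcard; apply/andP; split.
  apply/subsetP => y; rewrite inE => xy.
  by apply/imsetP; exists (Ordinal (card_between_out xy));
    rewrite -?arc_iter_succ.
by rewrite (leq_trans (leq_imset_card _ _)) // card_ord.
Qed.

Lemma inN_succ y : inN y = [set iter k.+1 (finv succ) y | k : 'I_(indeg y)].
Proof.
apply/eqP; rewrite eqEcard; apply/andP; split.
  apply/subsetP => x; rewrite inE => xy.
  apply/imsetP; exists (Ordinal (card_between_in xy)) => //=.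
  rewrite {2}(arc_iter_succ xy) -iterS; move: _.+1 => k.
  elim: k => // k IHk; rewrite iterSr iterS finv_f //; exact: succ_inj.
by rewrite (leq_trans (leq_imset_card _ _)) // card_ord.
Qed.

Lemma round_of_triangle_free : round D.
Proof.
have /card_gt0P[x0 _] := vertex_gt0 D.
pose v (i : 'I_#|D|) := iter i succ x0.
have ltD y : findex succ x0 y < #|D|.
  by rewrite -(order_succ x0) findex_max // fconnect_succ.
have vK : cancel v (fun y => Ordinal (ltD y)).
  by move=> i; apply: val_inj; rewrite /= findex_iter // order_succ.
have Kv : cancel (fun y => Ordinal (ltD y)) v.
  by move=> y; rewrite /v /= iter_findex // fconnect_succ.
(* At the last index the wrap-around is correct because n steps of [succ] return to [x0]. *)
have v_succ i : v (ordS i) = succ (v i).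
  rewrite /v /=; case: (ltngtP i.+1 #|D|) (ltn_ord i) => // [lt_i|E] _.
    by rewrite modn_small.
  rewrite -iterS E modnn -(order_succ x0) iter_order //; exact: succ_inj.
have v_pred i : v (ord_pred i) = finv succ (v i).
  by rewrite -[in RHS](ord_predK i) v_succ finv_f //; exact: succ_inj.
exists v; first by exists (fun y => Ordinal (ltD y)).
have v_iter f g k i : (forall j, v (f j) = g (v j)) ->
    v (iter k f i) = iter k g (v i).
  by move=> fg; elim: k => //= k <-.
move=> i; split; [rewrite [LHS]outN_succ | rewrite [LHS]inN_succ];
  apply: eq_imset => k; apply: esym; exact: v_iter.
Qed.

(** This Hamiltonian cycle ensures that the girth of the quotient exists. *)
Lemma has_dicycle_order : has_dicycle D #|D|.
Proof.
have /card_gt0P[x _] := vertex_gt0 D.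
exists (orbit succ x); first by rewrite size_orbit order_succ.
rewrite vertex_gt0 /ucycleb orbit_uniq andbT.
apply: sub_cycle (cycle_orbit succ_inj x) => a b /eqP <-; exact: arc_succ.
Qed.

End Round.

(** * Induced subdigraphs *)

Section Induced.
Variables (D : digraph) (P : pred D) (x0 : D).
Hypothesis Px0 : P x0.

Definition induced_arc : rel {x : D | P x} := fun x y => arc (val x) (val y).

Lemma induced_arc_irr : irreflexive induced_arc.
Proof. by move=> x; apply: arc_irr. Qed.

Lemma induced_gt0 : 0 < #|{: {x : D | P x}}|.
Proof. by apply/card_gt0P; exists (Sub x0 Px0). Qed.

Definition induced : digraph := Digraph induced_arc_irr induced_gt0.

End Induced.

(** * Contraction of the twin classes *)

Section Decomposition.
Variable D : digraph.
Hypotheses (tf : triangle_free D) (strongD : strong D).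
Hypothesis LSD : locally_semicomplete D.
Hypothesis D_gt2 : 2 < #|D|.
Implicit Types x y z w : D.

Definition twin x y := (x == y) || arc x y && arc y x.

Lemma twinxx x : twin x x.
Proof. by rewrite /twin eqxx. Qed.

Lemma twin_sym x y : twin x y = twin y x.
Proof. by rewrite /twin eq_sym andbC. Qed.

(** For three distinct vertices the hypotheses are contradictory: x and z are out-neighbours of y,
    hence adjacent, and either arc closes a 3-cycle through y. *)
Lemma twin_trans x y z : twin x y -> twin y z -> twin x z.
Proof.
rewrite /twin; case: (eqVneq x y) => [-> //|_] /= /andP[xy yx].
case: (eqVneq y z) => [<-|_] /=; first by rewrite xy yx orbT.
case: (eqVneq x z) => //= xz /andP[yz zy].
by case/orP: (out_arc LSD yx yz xz) => [xz'|zx];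
  [case: (tf xz' zy yx) | case: (tf zx xy yz)].
Qed.

Lemma twin_arc_out x y z : twin x y -> ~~ twin x z -> arc x z -> arc y z.
Proof.
case/orP => [/eqP <- //|/andP[xy yx]] xzN xz.
have yz : y != z by apply: contraNneq xzN => <-; rewrite /twin xy yx orbT.
by case/orP: (out_arc LSD xy xz yz) => // zy; case: (tf xz zy yx).
Qed.

Lemma twin_arc_in x y z : twin x y -> ~~ twin x z -> arc z x -> arc z y.
Proof.
case/orP => [/eqP <- //|/andP[xy yx]] xzN zx.
have yz : y != z by apply: contraNneq xzN => <-; rewrite /twin xy yx orbT.
by case/orP: (in_arc LSD yx zx yz) => // yz'; case: (tf xy yz' zx).
Qed.

(** Arcs between different classes depend only on the classes, so D is a composition over them. *)
Lemma twin_arc x x' y y' :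
  twin x x' -> twin y y' -> ~~ twin x y -> arc x y -> arc x' y'.
Proof.
move=> xx' yy' xyN /(twin_arc_out xx' xyN); apply: twin_arc_in yy' _.
by rewrite twin_sym; apply: contra xyN; apply: twin_trans.
Qed.

Definition rep x := choose (twin x) x.

Lemma twin_rep x : twin x (rep x).
Proof. exact: chooseP (twinxx x). Qed.

Lemma rep_eq x y : (rep x == rep y) = twin x y.
Proof.
apply/eqP/idP => [E|xy].
  by apply: twin_trans (twin_rep x) _; rewrite E twin_sym twin_rep.
have E : twin x =1 twin y.
  move=> z; apply/idP/idP; apply: twin_trans; first by rewrite twin_sym.
  by [].
by rewrite /rep (eq_choose E); apply: choose_id; rewrite ?twinxx // -E twinxx.
Qed.

Lemma rep_rep x : rep (rep x) == rep x.
Proof. by rewrite rep_eq twin_sym twin_rep. Qed.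

Lemma arc_rep x y : ~~ twin x y -> arc (rep x) (rep y) = arc x y.
Proof.
move=> xyN; apply/idP/idP; last first.
  by apply: twin_arc => //; apply: twin_rep.
apply: twin_arc; rewrite -rep_eq ?rep_rep //.
by rewrite !(eqP (rep_rep _)) rep_eq.
Qed.

Lemma twin_triple x y z :
  x != y -> y != z -> z != x -> twin x y -> twin y z -> twin z x -> False.
Proof.
rewrite /twin => /negPf-> /negPf-> /negPf-> /=.
move=> /andP[xy _] /andP[yz _] /andP[zx _].
exact: (tf xy yz zx).
Qed.

Let x0 : D := enum_val (Ordinal (vertex_gt0 D)).

(** Taking the subdigraph induced on representatives lets triangle-freeness and local
    semicompleteness be inherited from D. *)
Definition quotient : digraph :=
  @induced D (fun x => rep x == x) (rep x0) (rep_rep x0).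

Definition block (i : quotient) : digraph :=
  @induced D (fun x => rep x == val i) (val i) (valP i).

Definition class_of x : quotient :=
  exist (fun y => rep y == y) (rep x) (rep_rep x).

Lemma twin_quotient (i j : quotient) : twin (val i) (val j) -> i = j.
Proof. by rewrite -rep_eq (eqP (valP i)) (eqP (valP j)) => /eqP/val_inj. Qed.

Lemma class_of_val (i : quotient) : class_of (val i) = i.
Proof. by apply: val_inj; apply/eqP; apply: (valP i). Qed.

Lemma twin_block (i : quotient) (s t : block i) : twin (val s) (val t).
Proof. by rewrite -rep_eq (eqP (valP s)) (eqP (valP t)). Qed.

Lemma block_arc (i : quotient) (s t : block i) : s != t -> arc s t.
Proof.
move=> st; have := twin_block s t; rewrite /twin (inj_eq val_inj) (negPf st).
by case/andP.
Qed.

(** Paths of D are projected by [class_of]; an arc inside a class collapses to a point. *)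
Lemma quotient_strong : strong quotient.
Proof.
move=> i j; rewrite -(class_of_val j).
apply: (connect_closed_pred
  (P := fun x => connect (@arc quotient) i (class_of x)) _
  (strongD (val i) (val j))); last by rewrite class_of_val connect0.
move=> x y ix xy; apply: connect_trans ix _.
case: (boolP (twin x y)) => [|xyN]; last first.
  by apply: connect1; rewrite /= /induced_arc /= arc_rep.
by rewrite -rep_eq => /eqP E;
  rewrite (_ : class_of x = class_of y) ?connect0 //;
  apply: val_inj.
Qed.

Lemma quotient_triangle_free : triangle_free quotient.
Proof. by move=> i j k; apply: tf. Qed.

Lemma quotient_locally_semicomplete : locally_semicomplete quotient.
Proof.
by move=> i; split=> j k; rewrite !inE => ij ik jk;
  [apply: (in_arc LSD ij ik) | apply: (out_arc LSD ij ik)].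
Qed.

Lemma quotient_no_digon (i j : quotient) : arc i j -> ~~ arc j i.
Proof.
move=> ij; apply/negP => ji; have /twin_quotient E : twin (val i) (val j).
  by apply/orP; right; apply/andP.
by have := arc_neq ij; rewrite E eqxx.
Qed.

Lemma quotient_gt1 : 1 < #|quotient|.
Proof.
rewrite ltnNge; apply/negP => /card_le1_eqP le1.
have all_twin x y : twin x y.
  have /(congr1 sval) /= /eqP : class_of x = class_of y by apply: le1.
  by rewrite rep_eq.
have /card_gt2P[x [y [z [_ [xy yz zx]]]]] := D_gt2.
by apply: (twin_triple xy yz zx).
Qed.

Lemma card_block (i : quotient) : #|block i| <= 2.
Proof.
rewrite leqNgt; apply/card_gt2P => -[s [t [u [_ [st tu us]]]]].
by apply: (@twin_triple (val s) (val t) (val u));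
  rewrite ?(inj_eq val_inj) ?twin_block.
Qed.

Lemma isomorphic_composition : isomorphic D (composition block).
Proof.
pose f x : composition block :=
  Tagged (fun i => block i : Type)
    (exist _ x (eqxx (rep x)) : block (class_of x)).
pose g (p : composition block) : D := val (tagged p).
have fK : cancel f g by [].
have tagE p : val (tag p) = rep (g p) by rewrite (eqP (valP (tagged p))).
have g_inj : injective g.
  move=> p q E; have : tag p = tag q by apply: val_inj; rewrite !tagE E.
  case: p q E {tagE} => [i s] [j t] /= E ij; case: j / ij t E => t E.
  by congr existT; apply: val_inj.
exists f; first by exists g => //; apply: inj_can_sym fK g_inj.
suff arc_g p q : @comp_arc quotient block p q = arc (g p) (g q).
  by move=> x y; apply: arc_g.
rewrite /comp_arc; case: eqP => [|/eqP ij].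
  case: p q => [i s] [j t] /= ij; case: j / ij t => t.
  by rewrite tagged_asE.
change (arc (val (tag p)) (val (tag q)) = arc (g p) (g q)).
rewrite !tagE arc_rep // -rep_eq -!tagE.
by rewrite (inj_eq val_inj).
Qed.

Lemma DL_of_locally_semicomplete :
  exists (R : digraph) (S : R -> digraph),
    DL_decomposition D S /\ forall i : R, #|S i| <= 2.
Proof.
exists quotient, block; split; last exact: card_block.
have Rtf := quotient_triangle_free; have RLSD := quotient_locally_semicomplete.
have Rnd := quotient_no_digon.
have no2 : ~ has_dicycle quotient 2.
  move=> [[|i [|j []]] //= _ /andP[/and3P[ij ji _] _]].
  by case/negP: (Rnd _ _ ij).
split=> //.
- exact: isomorphic_composition.
- by split=> //; apply: round_of_triangle_free => //;
    [apply: quotient_strong | apply: quotient_gt1].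
- move=> i; split=> s t; last first.
    by move=> _ _ st; rewrite /adjacent block_arc.
  by case: (eqVneq s t) => [->|/block_arc/connect1//]; apply: connect0.
(* A boolean form, by tuples over a finite type, so that a least cycle length can be extracted. *)
pose dicycle k := [exists c : k.-tuple quotient,
    (0 < k) && ucycleb (@arc quotient) c].
have dicycleP k : reflect (has_dicycle quotient k) (dicycle k).
  apply: (iffP existsP) => [[c cP]|[c <- cP]]; last by exists (in_tuple c).
  by exists c; rewrite ?size_tuple.
have ex_dicycle : exists k, dicycle k.
  exists #|quotient|; apply/dicycleP; apply: has_dicycle_order => //.
    exact: quotient_strong.
  exact: quotient_gt1.
case: (ex_minnP ex_dicycle) => g /dicycleP gP gmin.
exists g; first by split=> // k /dicycleP; apply: gmin.
have -> : maxn 2 (\max_(i : quotient) #|block i|) = 2.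
  by apply/maxn_idPl/bigmax_leqP => i _; apply: card_block.
(* It remains to see 3 < g: lengths 0 to 3 are excluded by positivity and the absence of loops,
   2-cycles and 3-cycles. *)
case: g gP {gmin} => [|[|[|[|g]]]] // gP.
- by case: gP => c _ /andP[].
- case: gP => -[|i []] //= _ /andP[/andP[ii _] _].
  by have := arc_neq ii; rewrite eqxx.
- by case: (triangle_freeN3 Rtf gP).
Qed.

End Decomposition.

Theorem theorem1p4 (D : digraph)
    (order_ge3 : 3 <= #|D|)
    (strongD : strong D)
    (degree_cond : forall u : D,
      (exists v : D, nonadjacent_dominating_pair u v \/
                     nonadjacent_dominated_pair u v) ->
      #|D| <= deg u) :
  has_dicycle D 3 \/
  (~~ odd #|D| /\ class_DB D) \/
  (exists (R : digraph) (S : R -> digraph),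
      DL_decomposition D S /\ forall i : R, #|S i| <= 2).
Proof.
case: (has_dicycle3P D) => [|tf]; [by left | right].
case: (boolP [exists u : D, exists v : D, exists z : D,
    [&& u != v, ~~ adjacent u v &
        arc u z && arc v z || arc z u && arc z v]]).
  case/existsP=> u /existsP[v /existsP[z /and3P[u_v Nuv uvz]]]; left.
  have DB : class_DB D.
    apply: (class_DB_of_nonadjacent_pair (u := u) (v := v)) => //.
    by case/orP: uvz => uvz; [left | right]; split=> //; exists z.
  split=> //; case: DB => _ [A [cardA _ _ _]].
  by rewrite -(cardsC A) -cardA addnn odd_double.
(* Without such a pair, any two in-neighbours, or out-neighbours, of a vertex are adjacent. *)
move=> noPair; right; apply: DL_of_locally_semicomplete => //.
move=> z; split=> x y; rewrite !inE => xz yz xy; apply/negPn/negP => Nxy;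
  case/negP: noPair; apply/existsP; exists x; apply/existsP; exists y;
  by apply/existsP; exists z; rewrite xy Nxy xz yz ?orbT.
Qed.
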